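(* For every $0 < \alpha < 1$ there exist $\xi > 0$ and $n_0, t_0 \in \mathbb{N}$ such that the following holds. Suppose $G$ is an $(\alpha, t)$-expander with $n \ge n_0$ vertices, for some $t_0 \le t \le \sqrt{n}$. Then $G$ contains a complete minor of order (at least) $$\xi \sqrt{\frac{nt}{\log n}},$$ i.e. $K_r$ is a minor of $G$ for $r = \xi\sqrt{nt/\log n}$.
   Context: A graph $G$ with $n$ vertices is an $(\alpha,t)$-expander (for $t \ge 1$, $0<\alpha<1$) if every $X \subseteq V(G)$ with $|X| \le \alpha n/t$ satisfies $|N(X)| \ge t|X|$, where $N(X) = \{v \in V(G)\setminus X : \{v,x\}\in E(G) \text{ for some } x \in X\}$ is the external neighbourhood. A graph $H$ is a minor of $G$ if there are disjoint sets $\{W_h \subseteq V(G)\}_{h\in V(H)}$, each inducing a connected subgraph of $G$, with an edge of $G$ between $W_h$ and $W_{h'}$ for every $\{h,h'\}\in E(H)$. Rounding to integers is ignored. *)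

(* Defs.v *)
From HB Require Import structures.
From mathcomp Require Import all_boot all_order all_algebra.
From mathcomp Require Import reals exp.

Set Implicit Arguments.
Unset Strict Implicit.
Unset Printing Implicit Defensive.

Import Order.TTheory GRing.Theory Num.Theory.
Local Open Scope ring_scope.

Record sgraph := SGraph {
  vertex :> finType;
  adj : rel vertex;
  adj_sym : symmetric adj;
  adj_irr : irreflexive adj }.

Section Graphs.
Variable G : sgraph.

Definition ext_nbhd (X : {set G}) : {set G} :=
  [set v | (v \notin X) && [exists x in X, adj v x]].

(* Connected graphs are taken to be nonempty, so branch sets of a minor are
   nonempty even for isolated vertices. *)
Definition induces_connected (W : {set G}) : Prop :=
  W != set0 /\
  {in W &, forall x y,
     connect [rel u v | [&& u \in W, v \in W & adj u v]] x y}.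

(* The parameters are real numbers: no rounding is performed. *)
Definition expander (R : realType) (alpha t : R) : Prop :=
  [/\ 0 < alpha < 1, 1 <= t &
      forall X : {set G},
        #|X|%:R <= alpha * #|vertex G|%:R / t ->
        t * #|X|%:R <= #|ext_nbhd X|%:R].

End Graphs.

Definition minor (H G : sgraph) : Prop :=
  exists W : H -> {set G},
    [/\ forall h h' : H, h != h' -> [disjoint W h & W h'],
        forall h : H, induces_connected (W h) &
        forall h h' : H, adj h h' ->
          exists x y : G, [/\ x \in W h, y \in W h' & adj x y]].

Section Complete.
Variable r : nat.

Definition complete_adj : rel 'I_r := [rel x y | x != y].

Lemma complete_adj_sym : symmetric complete_adj.
Proof. by move=> x y; rewrite /complete_adj /= eq_sym. Qed.

Lemma complete_adj_irr : irreflexive complete_adj.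
Proof. by move=> x; rewrite /complete_adj /= eqxx. Qed.

Definition complete_graph : sgraph :=
  SGraph complete_adj_sym complete_adj_irr.

End Complete.

(* Main.v *)
(** Let [w] be about [sqrt (n ln n / t)].  Branch sets of size [w] are built one
    at a time; each has about [t w] neighbours, so about [w ln t / ln n]
    well-chosen vertices meet the neighbourhoods of all but a [1/t^2] fraction
    of the earlier branch sets.  The few missed ones are served by one extra
    vertex each.  All these vertices are joined by paths of length
    [O (ln n / ln t)], which costs only [O (w)] vertices in total.

    For such short paths to exist after the used vertices are deleted, one works
    inside a core [C] minimising [|N(A)| + eta |A|] over the large sets [A]:
    minimality says that large subsets of [C] expand inside [C].  Parts of [C]
    that stop expanding, and branch sets that lose their neighbourhoods, are
    moved to a garbage set [D].  The set [D] stays small, since its neighbours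
    lie outside [C], in branch sets, or among the at most [t |D| / 2] others.  A
    configuration maximal first in [|D|] and then in the number of branch sets
    is complete. *)

Require Import Defs.
From HB Require Import structures.
From mathcomp Require Import all_boot all_order all_algebra.
From mathcomp Require Import reals sequences exp.
From mathcomp Require Import boolp.
From mathcomp Require Import lra zify ring.

Set Implicit Arguments.
Unset Strict Implicit.
Unset Printing Implicit Defensive.

Import Order.TTheory GRing.Theory Num.Theory.
Local Open Scope ring_scope.

(** * Connected sets and balls *)

Section Connected.
Variable G : sgraph.
Implicit Types (X Y A P Q : {set G}) (x y z : G).

Lemma ext_nbhdP X v :
  reflect (v \notin X /\ exists2 x, x \in X & adj v x) (v \in ext_nbhd X).
Proof.
rewrite inE; apply: (iffP andP) => [[vX /exists_inP h]|[vX h]]; split=> //.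
exact/exists_inP.
Qed.

Lemma ext_nbhdU X Y : ext_nbhd (X :|: Y) \subset ext_nbhd X :|: ext_nbhd Y.
Proof.
apply/subsetP=> v /ext_nbhdP[]; rewrite inE negb_or => /andP[vX vY] [x xXY vx].
apply/setUP; case/setUP: xXY => xX; [left|right];
  by apply/ext_nbhdP; split=> //; exists x.
Qed.

Lemma connect_induced_sub P Q x y :
  connect [rel u v | [&& u \in P, v \in P & adj u v]] x y -> P \subset Q ->
  connect [rel u v | [&& u \in Q, v \in Q & adj u v]] x y.
Proof.
move=> cxy /subsetP PQ; apply: connect_sub cxy => u v /= /and3P[uP vP uv].
by apply: connect1; rewrite /= !PQ.
Qed.

Lemma induces_connected1 x : induces_connected [set x].
Proof.
split; first by apply/set0Pn; exists x; rewrite inE.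
by move=> u v; rewrite !inE => /eqP-> /eqP->; apply: connect0.
Qed.

Lemma induces_connectedU P Q z : z \in P -> z \in Q ->
  induces_connected P -> induces_connected Q -> induces_connected (P :|: Q).
Proof.
move=> zP zQ [_ cP] [_ cQ]; split.
  by apply/set0Pn; exists z; rewrite inE zP.
move=> u v uPQ vPQ; apply: (@connect_trans _ _ z).
  by case/setUP: uPQ => uX; [apply: (connect_induced_sub (cP _ _ uX zP))
    |apply: (connect_induced_sub (cQ _ _ uX zQ))]; rewrite ?subsetUl ?subsetUr.
by case/setUP: vPQ => vX; [apply: (connect_induced_sub (cP _ _ zP vX))
  |apply: (connect_induced_sub (cQ _ _ zQ vX))]; rewrite ?subsetUl ?subsetUr.
Qed.

Lemma induces_connected_add P y :
  y \in ext_nbhd P -> induces_connected P -> induces_connected (y |: P).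
Proof.
move=> /ext_nbhdP[_ [x xP yx]] cP; rewrite setUC.
have -> : P :|: [set y] = P :|: [set x; y].
  apply/setP=> v; rewrite !inE; by case: (v =P x) => [->|_]; rewrite ?xP.
apply: (induces_connectedU (z := x)) => //; first by rewrite !inE eqxx.
split; first by apply/set0Pn; exists x; rewrite !inE eqxx.
have xy : adj x y by rewrite adj_sym.
move=> u v /set2P[]-> /set2P[]->; rewrite ?connect0 //;
  by apply: connect1; rewrite /= !inE !eqxx ?orbT /= ?yx ?xy.
Qed.

(** For [x] in [A] this is the ball of radius [k] in the graph induced on [A]. Each step adds a
    layer disjoint from the ball so far, so sizes add up. *)
Fixpoint ball A x k : {set G} :=
  if k is k'.+1 then ball A x k' :|: (ext_nbhd (ball A x k') :&: A)
  else [set x].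

Lemma ball_center A x k : x \in ball A x k.
Proof. by elim: k => [|k IH] /=; rewrite !inE ?eqxx // IH. Qed.

Lemma ball_sub A x k : x \in A -> ball A x k \subset A.
Proof.
move=> xA; elim: k => [|k IH] /=; first by rewrite sub1set.
by rewrite subUset IH subsetIr.
Qed.

Lemma card_ballS A x k :
  #|ball A x k.+1| = (#|ball A x k| + #|ext_nbhd (ball A x k) :&: A|)%N.
Proof.
rewrite /= cardsU.
have -> : ball A x k :&: (ext_nbhd (ball A x k) :&: A) = set0.
  by apply/setP=> v; rewrite !inE; case: (v \in ball _ _ _).
by rewrite cards0 subn0.
Qed.

Lemma ball_connected A x k y : x \in A -> y \in ball A x k ->
  exists P, [/\ induces_connected P, P \subset A, x \in P, y \in P &
                (#|P| <= k.+1)%N].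
Proof.
move=> xA; elim: k y => [|k IH] y /=.
  rewrite inE => /eqP->; exists [set x]; split; rewrite ?inE ?cards1 ?sub1set //.
  exact: induces_connected1.
rewrite in_setU => /orP[/IH[P [cP PA xP yP lP]]|].
  by exists P; split=> //; apply: leq_trans lP _.
rewrite in_setI => /andP[/ext_nbhdP[yB [z zB yz]] yA].
have [P [cP PA xP zP lP]] := IH _ zB.
case: (boolP (y \in P)) => yP.
  by exists P; split=> //; apply: leq_trans lP _.
exists (y |: P); split.
- by apply: induces_connected_add => //; apply/ext_nbhdP; split=> //; exists z.
- by rewrite subUset sub1set yA.
- by rewrite inE xP orbT.
- by rewrite !inE eqxx.
- by rewrite cardsU1 yP.
Qed.

(** All the connecting sets share the root [x], so their union is connected and each costs at most
    [d] vertices besides the root. *)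
Lemma connected_hull A x d (S : seq G) : x \in A ->
  (forall y, y \in A -> exists P, [/\ induces_connected P, P \subset A,
     x \in P, y \in P & (#|P| <= d.+1)%N]) ->
  {subset S <= A} ->
  exists T, [/\ induces_connected T, T \subset A, {subset S <= T} &
                (#|T| <= (size S * d).+1)%N].
Proof.
move=> xA h SA.
suff [T [cT TA ST lT _]] : exists T, [/\ induces_connected T, T \subset A,
    {subset S <= T}, (#|T| <= (size S * d).+1)%N & x \in T].
  by exists T.
elim: S SA => [|y S IH] SA.
  exists [set x]; split; rewrite ?inE ?cards1 ?sub1set //.
  exact: induces_connected1.
have [|T [cT TA ST lT xT]] := IH.
  by move=> z zS; apply: SA; rewrite inE zS orbT.
have [|P [cP PA xP yP lP]] := h y; first by apply: SA; rewrite inE eqxx.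
exists (P :|: T); split; last by rewrite inE xP.
- exact: (induces_connectedU xP).
- by rewrite subUset PA.
- by move=> z; rewrite !inE => /orP[/eqP->|/ST->]; rewrite ?yP ?orbT.
have := cardsUI P T.
have : (0 < #|P :&: T|)%N by apply/card_gt0P; exists x; rewrite inE xP.
move: lP lT => /=; rewrite mulSn; lia.
Qed.

(** Neighbours inside [A] are added one at a time. Reaching the exact size [w] bounds the space
    taken by branch sets from above and their neighbourhoods from below. *)
Lemma connected_pad A T w : induces_connected T -> T \subset A ->
  (#|T| <= w)%N ->
  (forall X : {set G}, X \subset A -> X != set0 -> (#|X| < w)%N ->
     ext_nbhd X :&: A != set0) ->
  exists T', [/\ induces_connected T', T' \subset A, T \subset T' & #|T'| = w].
Proof.
move=> cT TA lT h; move: {2}(w - #|T|)%N (erefl (w - #|T|)%N) => k.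
elim: k T cT TA lT => [|k IH] T cT TA lT kE.
  by exists T; split=> //; apply/eqP; rewrite eqn_leq lT /= -subn_eq0 kE.
have Tw : (#|T| < w)%N by rewrite -subn_gt0 kE.
have /set0Pn[y] := h _ TA (proj1 cT) Tw.
rewrite in_setI => /andP[yT yA].
have yNT : y \notin T by case/ext_nbhdP: yT.
have [||||T' [cT' T'A TT' wT']] := IH (y |: T).
- exact: induces_connected_add.
- by rewrite subUset sub1set yA.
- by rewrite cardsU1 yNT.
- by rewrite cardsU1 yNT add1n subnS kE.
exists T'; split=> //; apply: subset_trans TT'; exact: subsetUr.
Qed.

End Connected.

(** * Core, hitting sets and diameter *)

(** [C] minimises [Psi] among sets of size at least [c * #|G|]; the whole vertex set competes
    because [c <= 1]. Comparison with it bounds the boundary of [C]. Comparison with [X] gives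
    expansion inside [C], as a neighbour of [X] outside [C] is a neighbour of [C]. *)
Lemma core_exists (R : realType) (G : sgraph) (c eta : R) :
  c <= 1 -> 0 <= eta ->
  exists C : {set G}, [/\ c * #|G|%:R <= #|C|%:R,
    #|ext_nbhd C|%:R <= eta * #|G|%:R &
    forall X : {set G}, X \subset C -> c * #|G|%:R <= #|X|%:R ->
      eta * (#|C|%:R - #|X|%:R) <= #|ext_nbhd X :&: C|%:R].
Proof.
move=> c1 eta0.
pose Psi (A : {set G}) : R := #|ext_nbhd A|%:R + eta * #|A|%:R.
have hT : c * #|G|%:R <= #|[set: G]|%:R :> R.
  by rewrite cardsT ler_piMl ?ler0n.
case: (@arg_minP _ _ _ [set: G] (fun A : {set G} => c * #|G|%:R <= #|A|%:R :> R)
  Psi hT) => C hC minC.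
exists C; split=> // [|X XC hX].
  have := minC _ hT; rewrite /Psi cardsT.
  have -> : ext_nbhd [set: G] = set0.
    by apply/setP=> v; rewrite !inE.
  rewrite cards0 add0r; apply: le_trans; rewrite lerDl mulr_ge0 //.
have := minC _ hX; rewrite /Psi.
have : (#|ext_nbhd X| <= #|ext_nbhd C| + #|ext_nbhd X :&: C|)%N.
  apply: leq_trans (leq_card_setU _ _); apply: subset_leq_card.
  apply/subsetP=> v vX; rewrite in_setU in_setI vX /=.
  case: (boolP (v \in C)) => vC; rewrite ?orbT ?orbF //.
  case/ext_nbhdP: vX => _ [x xX vx]; apply/ext_nbhdP; split=> //.
  by exists x => //; apply: (subsetP XC).
rewrite -(ler_nat R) natrD; lra.
Qed.

(** By averaging, some vertex of [A] lies in at least a fraction [p] of the sets not yet hit, so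
    each choice multiplies the number missed by at most [1 - p]. *)
Lemma greedy_hitting (R : realType) (T I : finType) (F : {set I})
    (f : I -> {set T}) (A : {set T}) (p : R) :
  A != set0 -> 0 <= p <= 1 ->
  (forall i, i \in F -> f i \subset A /\ p * #|T|%:R <= #|f i|%:R) ->
  forall s : nat, exists S : seq T, [/\ (size S <= s)%N, {subset S <= A} &
    #|[set i in F | ~~ has (mem (f i)) S]|%:R <= #|F|%:R * (1 - p) ^+ s].
Proof.
move=> A0 /andP[p0 p1] hf; elim=> [|s [S [lS SA hS]]].
  exists [::]; split=> //; rewrite expr0 mulr1 ler_nat subset_leq_card //.
  by apply/subsetP=> i; rewrite inE => /andP[].
set M := [set i in F | _] in hS.
have [v vA hv] : exists2 v, v \in A &
    p * #|M|%:R <= #|[set i in M | v \in f i]|%:R.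
  apply: contrapT => hno.
  have lt v : v \in A -> #|[set i in M | v \in f i]|%:R < p * #|M|%:R.
    by move=> vA; rewrite ltNge; apply/negP => h; apply: hno; exists v.
  (* Pairs [(v, i)] with [v] in [f i] are counted in two ways. Without a good [v] the count would be
     below [p * #|M| * #|A|], yet it is at least [p * #|M| * #|T|]. *)
  have e : (\sum_(v in A) #|[set i in M | v \in f i]| = \sum_(i in M) #|f i|)%N.
    under eq_bigr do rewrite -sum1_card.
    under [RHS]eq_bigr do rewrite -sum1_card.
    rewrite (exchange_big_dep (mem M)) /=; last first.
      by move=> v i _; rewrite inE => /andP[].
    apply: eq_bigr => i iM; apply: eq_bigl => v; rewrite inE iM /=.
    have iF : i \in F by move: iM; rewrite inE => /andP[].
    by case: (boolP (v \in f i)) => h; rewrite ?andbF // (subsetP (hf _ iF).1).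
  have := congr1 (fun k : nat => k%:R : R) e; rewrite !natr_sum => eR.
  have : \sum_(v in A) #|[set i in M | v \in f i]|%:R
      < \sum_(v in A) (p * #|M|%:R).
    apply: ltr_sum; last by move=> v /lt.
    by case/set0Pn: A0 => v vA; apply/hasP; exists v; rewrite ?mem_index_enum.
  rewrite eR sumr_const -mulr_natl ltNge => /negP; apply.
  apply: (@le_trans _ _ (\sum_(i in M) (p * #|T|%:R))); last first.
    by apply: ler_sum => i; rewrite inE => /andP[/hf[]].
  rewrite sumr_const -mulr_natl.
  have : p * #|M|%:R * #|A|%:R <= p * #|M|%:R * #|T|%:R.
    by rewrite ler_wpM2l ?mulr_ge0 // ler_nat max_card.
  lra.
exists (v :: S); split.
- by rewrite /= ltnS.
- by move=> u; rewrite inE => /orP[/eqP->|/SA].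
set M' := [set i in F | _].
have : (#|M'| + #|[set i in M | v \in f i]| <= #|M|)%N.
  rewrite -(cardsID [set i in M | v \in f i] M) addnC leq_add //.
    by rewrite subset_leq_card //; apply/subsetP=> i; rewrite !inE => /andP[->->].
  apply: subset_leq_card; apply/subsetP=> i.
  rewrite !inE /= negb_or; case/andP=> -> /andP[h ->].
  by rewrite -!topredE /= in h *; rewrite (negbTE h).
rewrite -(ler_nat R) natrD exprSr => hM.
have := ler_wpM2r (_ : 0 <= 1 - p) hS; rewrite subr_ge0 => /(_ p1); lra.
Qed.

(** Balls grow by the factor [tau] until they exceed [a] (at most [l] steps), reach [tau * a] in one
    more step, then gain [g] per step until they fill more than half of [C] (at most [q] steps). Two
    such balls inside [C] must meet. *)
Lemma small_diameter (R : realType) (G : sgraph) (A C : {set G}) (tau g : R)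
    (a l q : nat) :
  A \subset C -> (0 < a)%N -> (a < #|G|)%N -> 0 <= tau -> 0 <= g ->
  #|G|%:R <= tau ^+ l -> #|G|%:R <= q%:R * g ->
  (forall X : {set G}, X \subset A -> X != set0 -> (#|X| <= a)%N ->
     tau * #|X|%:R <= #|ext_nbhd X :&: A|%:R) ->
  (forall X : {set G}, X \subset A -> tau * a%:R <= #|X|%:R ->
     (#|X|.*2 <= #|C|)%N -> g <= #|ext_nbhd X :&: A|%:R) ->
  forall x y, x \in A -> y \in A ->
  exists P : {set G}, [/\ induces_connected P, P \subset A, x \in P, y \in P &
    (#|P| <= ((l + q).+1.*2).+1)%N].
Proof.
move=> AC a0 an tau0 g0 hl hq E1 E2.
have sub x k : x \in A -> ball A x k \subset A by exact: ball_sub.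
have ne x k : ball A x k != set0.
  by apply/set0Pn; exists x; exact: ball_center.
have b1 x k : x \in A -> (a < #|ball A x k|)%N \/ tau ^+ k <= #|ball A x k|%:R.
  move=> xA; elim: k => [|k [IH|IH]]; first by right; rewrite cards1.
    by left; apply: leq_trans IH _; rewrite card_ballS leq_addr.
  case: (ltnP a #|ball A x k|) => h.
    by left; apply: leq_trans h _; rewrite card_ballS leq_addr.
  right; rewrite card_ballS natrD exprS.
  have := E1 _ (sub x k xA) (ne x k) h.
  have := ler_wpM2l tau0 IH; have := ler0n R #|ball A x k|; lra.
have b2 x : x \in A -> (a < #|ball A x l|)%N.
  move=> xA; case: (b1 x l xA) => // h; apply: leq_trans an _.
  by rewrite -(ler_nat R) (le_trans hl h).
have b3 x : x \in A -> tau * a%:R <= #|ball A x l.+1|%:R.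
  (* The ball may already be too large for [E1], so [E1] is applied to a subset [Y] of exactly [a]
     vertices; its neighbours in [A] all lie in the next ball. *)
  move=> xA; have [Y YB Ya] : exists2 Y : {set G}, Y \subset ball A x l & #|Y| = a.
    have := ltnW (b2 x xA); move: (ball A x l) => B aB.
    exists [set v in take a (enum B)].
      by apply/subsetP=> v; rewrite inE => /mem_take; rewrite mem_enum.
    rewrite cardsE; have /card_uniqP-> : uniq (take a (enum B)).
      by rewrite take_uniq // enum_uniq.
    by rewrite size_takel // -cardE.
  have YA := subset_trans YB (sub x l xA).
  have Y0 : Y != set0 by rewrite -card_gt0 Ya.
  have := E1 _ YA Y0; rewrite Ya => /(_ (leqnn _)) h; apply: le_trans h _.
  rewrite ler_nat subset_leq_card //; apply/subsetP=> v.
  rewrite /= !in_setU !in_setI => /andP[/ext_nbhdP[_ [y yY vy]] ->].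
  rewrite andbT; case: (boolP (v \in ball A x l)) => //= vB.
  by apply/ext_nbhdP; split=> //; exists y => //; apply: (subsetP YB).
have b4 x k : x \in A -> (#|C| < #|ball A x (l.+1 + k)|.*2)%N \/
    tau * a%:R <= #|ball A x (l.+1 + k)|%:R /\
    k%:R * g <= #|ball A x (l.+1 + k)|%:R.
  move=> xA; elim: k => [|k IH].
    by right; rewrite addn0 mul0r; split=> //; apply: b3.
  rewrite addnS.
  have mono : (#|ball A x (l.+1 + k)| <= #|ball A x (l.+1 + k).+1|)%N.
    by rewrite (card_ballS A x _) leq_addr.
  case: IH => [IH|[h1 h2]].
    by left; apply: leq_trans IH _; rewrite leq_double.
  case: (ltnP #|C| #|ball A x (l.+1 + k)|.*2) => h.
    by left; apply: leq_trans h _; rewrite leq_double.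
  right; split; first by apply: le_trans h1 _; rewrite ler_nat.
  have := E2 _ (sub x _ xA) h1 h.
  have := congr1 (fun m : nat => m%:R : R) (card_ballS A x (l.+1 + k)).
  by rewrite natrD => ->; rewrite -(addn1 k) natrD mulrDl mul1r; lra.
have b5 x : x \in A -> (#|C| < #|ball A x (l.+1 + q)|.*2)%N.
  move=> xA; case: (b4 x q xA) => // -[_ h].
  (* After [q] slow steps without passing half of [C], the ball would contain every vertex of [G],
     hence more than half of [C] anyway. *)
  have : (#|G| <= #|ball A x (l.+1 + q)|)%N.
    by rewrite -(ler_nat R) (le_trans hq h).
  have := subset_leq_card (subsetT C); rewrite cardsT; move: an; lia.
move=> x y xA yA.
have /set0Pn[z] : ball A x (l.+1 + q) :&: ball A y (l.+1 + q) != set0.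
  rewrite -card_gt0.
  have := cardsUI (ball A x (l.+1 + q)) (ball A y (l.+1 + q)).
  have := b5 _ xA; have := b5 _ yA.
  have : (#|ball A x (l.+1 + q) :|: ball A y (l.+1 + q)| <= #|C|)%N.
    by rewrite subset_leq_card // (subset_trans _ AC) // subUset !sub.
  lia.
rewrite in_setI => /andP[/(ball_connected xA)[P [cP PA xP zP lP]]
  /(ball_connected yA)[Q [cQ QA yQ zQ lQ]]].
exists (P :|: Q); split; rewrite ?inE ?xP ?yQ ?orbT //.
- exact: (induces_connectedU zP zQ).
- by rewrite subUset PA.
have := cardsUI P Q.
have : (0 < #|P :&: Q|)%N by apply/card_gt0P; exists z; rewrite inE zP.
by move: lP lQ; clear; lia.
Qed.

(** * Packings of branch sets *)

Section Packing.
Variables (R : realType) (G : sgraph) (alpha t : R) (C : {set G}) (w r : nat).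
Implicit Types (D X B : {set G}) (F : {set {set G}}).

Definition alive D F := C :\: (D :|: cover F).

Definition touches B B' := exists x y : G, [/\ x \in B, y \in B' & adj x y].

(* D is the garbage and F the family of branch sets built so far. *)
Record packing D F : Prop := Packing {
  pk_sub : D \subset C;
  pk_card : (#|F| <= r)%N;
  pk_mem : forall B, B \in F ->
    [/\ B \subset C :\: D, #|B| = w & induces_connected B];
  pk_pair : forall B B', B \in F -> B' \in F -> B != B' ->
    [disjoint B & B'] /\ touches B B';
  pk_small : t * #|D|%:R <= alpha * #|G|%:R;
  pk_sparse : #|ext_nbhd D :&: alive D F|%:R <= t / 2 * #|D|%:R }.

Lemma touches_sym B B' : touches B B' -> touches B' B.
Proof. by case=> x [y [xB yB xy]]; exists y, x; rewrite adj_sym. Qed.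

Lemma card_cover_packing D F : packing D F -> (#|cover F| <= r * w)%N.
Proof.
case=> _ Fr hF _ _ _; apply: leq_trans (leq_card_cover F) _.
rewrite (eq_bigr (fun=> w)) => [|B /hF[] //].
by rewrite sum_nat_const leq_mul2r Fr orbT.
Qed.

Hypothesis expand : forall X, t * #|X|%:R <= alpha * #|G|%:R ->
  t * #|X|%:R <= #|ext_nbhd X|%:R.

(** Expansion gives [D] at least [t * #|D|] neighbours, and at most half of that number are alive.
    The others lie outside [C] or in branch sets, and both places are small. *)
Lemma packing_garbage D F : packing D F ->
  t * #|D|%:R <= 2 * (#|ext_nbhd C|%:R + (r * w)%:R).
Proof.
move=> pk; have := expand (pk_small pk); have := pk_sparse pk.
have : (#|ext_nbhd D| <= #|ext_nbhd C| + r * w + #|ext_nbhd D :&: alive D F|)%N.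
  apply: leq_trans (leq_add (leq_add (leqnn _) (card_cover_packing pk)) (leqnn _)).
  apply: leq_trans (leq_add (leq_card_setU _ _) (leqnn _)).
  apply: leq_trans (leq_card_setU _ _); apply: subset_leq_card.
  apply/subsetP=> v vD; rewrite !in_setU in_setI vD in_setD in_setU /=.
  have vnD : v \notin D by case/ext_nbhdP: vD.
  rewrite (negbTE vnD) /=.
  case: (boolP (v \in cover F)) => vF; rewrite ?orbT //=.
  case: (boolP (v \in C)) => vC; rewrite ?orbT ?orbF //.
  case/ext_nbhdP: vD => _ [x xX vx]; apply/ext_nbhdP; split=> //.
  by exists x => //; apply: (subsetP (pk_sub pk)).
rewrite -(ler_nat R) !natrD; lra.
Qed.

(** The sparsity bounds of [D] and [X] add up. The inclusion of alive parts ensures that dropping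
    branch sets from [F] releases no new alive neighbours of [D]. *)
Lemma packing_absorb D F F' X : packing D F -> F' \subset F ->
  X \subset C :\: D -> (forall B, B \in F' -> [disjoint B & X]) ->
  alive (D :|: X) F' \subset alive D F ->
  t * (#|D|%:R + #|X|%:R) <= alpha * #|G|%:R ->
  #|ext_nbhd X :&: alive D F|%:R <= t / 2 * #|X|%:R ->
  packing (D :|: X) F'.
Proof.
move=> pk /subsetP F'F XCD FX sA small sparse.
have dDX : #|D :|: X| = (#|D| + #|X|)%N.
  rewrite cardsU; have -> : D :&: X = set0.
    apply/setP=> v; rewrite !inE; apply/negP=> /andP[vD /(subsetP XCD)].
    by rewrite inE vD.
  by rewrite cards0 subn0.
split.
- by rewrite subUset (pk_sub pk) (subset_trans XCD) ?subsetDl.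
- by apply: leq_trans (pk_card pk); apply: subset_leq_card; apply/subsetP.
- move=> B BF'; have [BCD Bw cB] := pk_mem pk (F'F _ BF'); split=> //.
  apply/subsetP=> v vB; move/subsetP/(_ v vB): BCD.
  rewrite !inE negb_or => /andP[-> ->]; rewrite andbT /=.
  by have /disjointFr -> := FX _ BF'.
- by move=> B B' /F'F BF /F'F BF'; apply: (pk_pair pk).
- by rewrite dDX natrD.
rewrite dDX natrD mulrDr; apply: le_trans (lerD (pk_sparse pk) sparse).
rewrite -natrD ler_nat; apply: leq_trans (leq_card_setU _ _).
apply: subset_leq_card; rewrite -setIUl.
by apply: setISS => //; apply: ext_nbhdU.
Qed.

Lemma packing0 : 0 <= alpha -> 0 <= t -> packing set0 set0.
Proof.
move=> a0 t0; split.
- exact: sub0set.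
- by rewrite cards0.
- by move=> B; rewrite inE.
- by move=> B B'; rewrite inE.
- by rewrite cards0 mulr0 mulr_ge0.
have -> : ext_nbhd set0 = set0 :> {set G}.
  by apply/setP=> v; apply/ext_nbhdP; rewrite inE => -[_ [x]]; rewrite inE.
by rewrite set0I cards0 mulr0.
Qed.

(* As at most r branch sets are allowed, this orders packings
   lexicographically, by garbage size first. *)
Definition weight (s : {set G} * {set {set G}}) := (#|s.1| * r.+1 + #|s.2|)%N.

Lemma packing_max : 0 <= alpha -> 0 <= t ->
  exists D F, packing D F /\
    forall D' F', packing D' F' -> (weight (D', F') <= weight (D, F))%N.
Proof.
move=> a0 t0.
case: (@arg_maxnP _ (set0 : {set G}, set0 : {set {set G}})
  (fun s => `[< packing s.1 s.2 >]) weight).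
  by apply/asboolP; apply: packing0.
move=> [D F] /asboolP pk hmax; exists D, F; split=> // D' F' pk'.
by apply: (hmax (D', F')); apply/asboolP.
Qed.

(** A single new garbage vertex adds [r.+1], more than the at most [r] branch sets that may be
    lost. *)
Lemma weight_absorb D F F' X : packing D F -> X != set0 ->
  [disjoint D & X] -> (weight (D, F) < weight (D :|: X, F'))%N.
Proof.
move=> pk X0 dDX; rewrite /weight /= cardsU disjoint_setI0 // cards0 subn0.
rewrite mulnDl; have := pk_card pk; move: X0; rewrite -card_gt0.
case: #|X| => // k _ h; rewrite mulSn -addnA ltn_add2l -addnA ltnS.
by apply: leq_trans h _; exact: leq_addr.
Qed.

(* Otherwise moving X to the garbage yields a heavier packing. *)
Lemma packing_max_expand D F X :
  packing D F ->
  (forall D' F', packing D' F' -> (weight (D', F') <= weight (D, F))%N) ->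
  t * (#|D|%:R + #|X|%:R) <= alpha * #|G|%:R ->
  X != set0 -> X \in F \/ X \subset alive D F ->
  t / 2 * #|X|%:R < #|ext_nbhd X :&: alive D F|%:R.
Proof.
move=> pk hmax small X0 hX; rewrite ltNge; apply/negP => sparse.
have [F' [F'F FX XCD sA]] : exists F', [/\ F' \subset F,
    forall B, B \in F' -> [disjoint B & X], X \subset C :\: D &
    alive (D :|: X) F' \subset alive D F].
  (* A branch set leaves the family when it becomes garbage; an alive set [X] meets no branch set,
     so then the family is kept. *)
  case: hX => hX.
    exists (F :\ X); split; first exact: subD1set.
    - move=> B; rewrite !inE => /andP[BX BF].
      by have [] := pk_pair pk BF hX BX.
    - by have [] := pk_mem pk hX.
    apply/subsetP=> v; rewrite !inE !negb_or -!andbA => /and4P[-> vX vF ->].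
    rewrite andbT /=; apply: contra vF => /bigcupP[B BF vB].
    apply/bigcupP; exists B => //; rewrite !inE BF andbT.
    by apply: contra vX => /eqP<-.
  exists F; split=> //.
  - move=> B BF; rewrite disjoint_sym disjoints_subset.
    apply: subset_trans hX _; apply/subsetP=> v; rewrite !inE negb_or.
    case/andP=> /andP[_ vF] _; apply: contra vF => vB.
    by apply/bigcupP; exists B.
  - apply: subset_trans hX _; apply/subsetP=> v; rewrite !inE negb_or.
    by case/andP=> /andP[-> _] ->.
  by apply/subsetP=> v; rewrite !inE !negb_or -!andbA => /and4P[-> _ -> ->].
have pk' := packing_absorb pk F'F XCD FX sA small sparse.
have := hmax _ _ pk'; rewrite leqNgt => /negP; apply.
apply: weight_absorb => //.
rewrite disjoint_sym disjoints_subset; apply: subset_trans XCD _.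
by apply/subsetP=> v; rewrite !inE => /andP[].
Qed.

(** Garbage is unchanged and the alive part only shrinks, so sparsity survives while the weight
    grows by one. *)
Lemma packing_add D F B : packing D F -> (#|F| < r)%N ->
  B \subset alive D F -> #|B| = w -> induces_connected B ->
  (forall B', B' \in F -> touches B B') ->
  packing D (B |: F) /\ (weight (D, F) < weight (D, B |: F))%N.
Proof.
move=> pk Fr BA Bw cB tB.
have dB B' : B' \in F -> [disjoint B & B'].
  move=> BF; rewrite disjoints_subset.
  apply: subset_trans BA _; apply/subsetP=> v; rewrite !inE negb_or.
  case/andP=> /andP[_ vF] _; apply: contra vF => vB.
  by apply/bigcupP; exists B'.
have BF : B \notin F.
  apply/negP => /dB; rewrite -setI_eq0 setIid => /eqP B0.
  by case: cB; rewrite B0 eqxx.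
have cF : #|B |: F| = #|F|.+1 by rewrite cardsU1 BF.
split; last by rewrite /weight /= cF addnS.
split.
- exact: pk_sub pk.
- by rewrite cF.
- move=> B'; rewrite !inE => /orP[/eqP->|/(pk_mem pk)//]; split=> //.
  apply: subset_trans BA _; apply/subsetP=> v; rewrite !inE negb_or.
  by case/andP=> /andP[-> _] ->.
- move=> B1 B2; rewrite !inE => /orP[/eqP->|h1] /orP[/eqP->|h2];
    rewrite ?eqxx // => ne.
  + by split; [apply: dB|apply: tB].
  + by split; [rewrite disjoint_sym; apply: dB|apply: touches_sym; apply: tB].
  exact: pk_pair pk _ _ h1 h2 ne.
- exact: pk_small pk.
apply: le_trans (pk_sparse pk); rewrite ler_nat subset_leq_card //.
apply: setIS; apply/subsetP=> v; rewrite !inE !negb_or -!andbA.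
case/and3P=> -> vF ->; rewrite andbT /=; apply: contra vF => /bigcupP[B' B'F vB].
by apply/bigcupP; exists B' => //; rewrite !inE B'F orbT.
Qed.

Lemma packing_minor D F : packing D F -> #|F| = r -> minor (complete_graph r) G.
Proof.
move=> pk Fr; exists (fun i : 'I_r => enum_val (cast_ord (esym Fr) i)).
have mem (i : 'I_r) : enum_val (cast_ord (esym Fr) i) \in F by apply: enum_valP.
have ne (i j : 'I_r) : i != j ->
    enum_val (cast_ord (esym Fr) i) != enum_val (cast_ord (esym Fr) j).
  by apply: contra => /eqP/enum_val_inj/cast_ord_inj->.
split=> [i j /ne ij|i|i j ij].
- by have [] := pk_pair pk (mem i) (mem j) ij.
- by have [] := pk_mem pk (mem i).
by have [] := pk_pair pk (mem i) (mem j) (ne i j ij).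
Qed.

End Packing.

(** * Building a branch set and completing a maximal packing *)

(** Greedy choice supplies at most [s] vertices, and each set still missed gets a representative of
    its own. The hull of all of them from one root has size at most [w] and is padded to exactly
    [w]. *)
Lemma new_branch_set (R : realType) (G : sgraph) (I : finType) (F : {set I})
    (f : I -> {set G}) (A : {set G}) (p : R) (d s w : nat) :
  A != set0 -> 0 <= p <= 1 ->
  (forall x y, x \in A -> y \in A -> exists P : {set G},
    [/\ induces_connected P, P \subset A, x \in P, y \in P & (#|P| <= d.+1)%N]) ->
  (forall i, i \in F -> [/\ f i \subset A, f i != set0 &
     p * #|G|%:R <= #|f i|%:R]) ->
  (forall X : {set G}, X \subset A -> X != set0 -> (#|X| < w)%N ->
     ext_nbhd X :&: A != set0) ->
  (forall M : nat, M%:R <= #|F|%:R * (1 - p) ^+ s -> ((s + M) * d < w)%N) ->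
  exists B : {set G}, [/\ induces_connected B, B \subset A, #|B| = w &
    forall i, i \in F -> f i :&: B != set0].
Proof.
move=> A0 p01 hd hf hA hw; case/set0Pn: (A0) => x0 x0A.
have [i /hf[] //|S [lS SA hS]] := @greedy_hitting R G I F f A p A0 p01 _ s.
set M := [set i in F | _] in hS.
(* The default [x0] is never taken on [F], where every [f i] is nonempty. *)
pose g i := odflt x0 [pick v in f i].
have gf i : i \in F -> g i \in f i.
  move=> iF; rewrite /g; case: pickP => [v //|h].
  by have [_ /set0Pn[v]] := hf _ iF; rewrite h.
have [|T [cT TA ST lT]] :=
    @connected_hull G A x0 d (S ++ [seq g i | i <- enum M]) x0A (hd _ ^~ x0A).
  move=> v; rewrite mem_cat => /orP[/SA //|/mapP[i]].
  rewrite mem_enum inE => /andP[iF _] ->.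
  by have [/subsetP fA _ _] := hf _ iF; apply/fA/gf.
(* The root contributes the extra one, which the strict inequality in [hw] absorbs. *)
have lTw : (#|T| <= w)%N.
  apply: leq_trans lT _; apply: leq_ltn_trans (hw _ hS).
  by rewrite size_cat size_map -cardE leq_mul2r leq_add2r lS orbT.
have [B [cB BA TB Bw]] := connected_pad cT TA lTw hA.
exists B; split=> // i iF.
have [v vS vi] : exists2 v, v \in S ++ [seq g i | i <- enum M] & v \in f i.
  case: (boolP (has (mem (f i)) S)) => [/hasP[v vS vi]|h].
    by exists v => //; rewrite mem_cat vS.
  exists (g i); last exact: gf.
  by rewrite mem_cat; apply/orP; right; apply: map_f; rewrite mem_enum inE iF.
by apply/set0Pn; exists v; rewrite inE vi (subsetP TB) // ST.
Qed.

(** A packing of maximal weight with fewer than [r] branch sets would admit one more: the sets to be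
    hit are the alive neighbourhoods of the existing branch sets, and the alive part has small
    diameter. *)
Lemma expander_complete_minor (R : realType) (G : sgraph)
    (alpha t c eta g p : R) (a l q s w r : nat) :
  let n : R := #|G|%:R in
  0 < alpha < 1 -> 1 <= t ->
  (forall X : {set G}, t * #|X|%:R <= alpha * n -> t * #|X|%:R <= #|ext_nbhd X|%:R) ->
  0 < c <= 1 -> 0 <= eta <= 1 -> 0 <= g -> 0 <= p <= 1 ->
  (0 < w)%N -> (w <= a)%N -> 2 * t * a%:R <= alpha * n -> c * n <= t / 2 * a%:R ->
  4 * (eta * n + (r * w)%:R) <= alpha * n ->
  2 * (eta * n + (r * w)%:R) / t + (r * w)%:R + g <= eta * (c * n) / 2 ->
  n <= (t / 2) ^+ l -> n <= q%:R * g -> p * n <= t / 2 * w%:R ->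
  (forall M : nat, M%:R <= r%:R * (1 - p) ^+ s ->
     ((s + M) * (l + q).+1.*2 < w)%N) ->
  minor (complete_graph r) G.
Proof.
move=> n /andP[al0 al1] t1 expand /andP[c0 c1] /andP[eta0 eta1] g0 p01 w0 wa ha
  hc hsm hgap hl hq hp hw.
have t0 : 0 < t by apply: lt_le_trans t1.
have aR0 : 0 < a%:R :> R by rewrite ltr0n (leq_trans w0).
have n0 : 0 < n.
  have : 0 < t * a%:R by rewrite mulr_gt0.
  by rewrite -(pmulr_rgt0 n al0); lra.
have [C [hC1 hC2 hC3]] := @core_exists R G c eta c1 eta0.
have [D [F [pk hmax]]] := packing_max C w r (ltW al0) (ltW t0).
have cF := pk_card pk.
case: (eqVneq #|F| r) => [h|Fr']; first exact: packing_minor pk h.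
have Fr : (#|F| < r)%N by rewrite ltn_neqAle Fr'.
exfalso.
have hD := packing_garbage expand pk.
(* Garbage uses at most half of the size allowed by [pk_small], leaving room to absorb any further
   set of at most [a] vertices. *)
have DsG : t * #|D|%:R <= alpha * n / 2.
  by move: hD; rewrite -/n; rewrite -/n in hC2; lra.
have hE (X : {set G}) : (#|X| <= a)%N -> X != set0 -> X \in F \/ X \subset alive C D F ->
    t / 2 * #|X|%:R < #|ext_nbhd X :&: alive C D F|%:R.
  move=> Xa; apply: (packing_max_expand pk hmax).
  have : t * #|X|%:R <= t * a%:R by rewrite ler_wpM2l ?ler_nat // ltW.
  by rewrite mulrDr -/n; lra.
set A := alive C D F in hE.
have AC : A \subset C by apply: subsetDl.
have CA : #|C|%:R <= #|A|%:R + #|D|%:R + (r * w)%:R :> R.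
  rewrite -!natrD ler_nat -addnA.
  apply: leq_trans (leq_add (leqnn _) (leq_add (leqnn _) (card_cover_packing pk))).
  apply: leq_trans (leq_add (leqnn _) (leq_card_setU _ _)).
  rewrite addnC -(cardsID (D :|: cover F) C) leq_add2r subset_leq_card //.
  exact: subsetIr.
have Dd : #|D|%:R + (r * w)%:R + g <= eta * (c * n) / 2.
  apply: le_trans hgap; rewrite !lerD2r ler_pdivlMr // mulrC.
  by apply: le_trans hD _; rewrite ler_pM2l // lerD2r.
have cn0 : 0 < c * n by rewrite mulr_gt0.
have A0 : A != set0.
  rewrite -card_gt0 -(ltr_nat R).
  have : eta * (c * n) <= 1 * (c * n) by rewrite ler_wpM2r // ltW.
  rewrite -/n in hC1; lra.
have an : (a < #|G|)%N.
  rewrite -(ltr_nat R) -/n.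
  have : alpha * n < 1 * n by rewrite ltr_pM2r.
  have : 1 * a%:R <= t * a%:R by rewrite ler_wpM2r // ltW.
  lra.
have th0 : 0 <= t / 2 by lra.
have Nne (X : {set G}) : X \subset A -> X != set0 -> (#|X| <= a)%N ->
    ext_nbhd X :&: A != set0.
  move=> XA X0 Xa; rewrite -card_gt0 -(ltr_nat R).
  by apply: le_lt_trans (hE X Xa X0 (or_intror XA)); rewrite mulr_ge0.
have [||x y xA yA|i iF|X XA X0 Xw|M hM|B [cB BA Bw hB]] :=
    @new_branch_set R G _ F (fun B => ext_nbhd B :&: A) A p (l + q).+1.*2 s w.
- exact: A0.
- exact: p01.
- apply: (small_diameter (R := R) (C := C) (tau := t / 2) (g := g) (a := a)) => //.
  + exact: leq_trans wa.
  + by move=> X XA X0 Xa; apply/ltW/hE => //; right.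
  (* [hc] makes [X] large enough for the expansion of the core. As [X] is at most half of [C], it
     has at least [eta * #|C| / 2] neighbours in [C]; removing those in the garbage or in branch
     sets leaves [g] by [Dd]. *)
  move=> X XA Xbig Xhalf.
  have := hC3 X (subset_trans XA AC) (le_trans hc Xbig).
  have : (#|ext_nbhd X :&: C| <= #|ext_nbhd X :&: A| + #|C :\: A|)%N.
    apply: leq_trans (leq_card_setU _ _); apply: subset_leq_card.
    apply/subsetP=> v; rewrite in_setU !in_setI in_setD => /andP[-> ->].
    by case: (v \in A).
  have : #|C|%:R = #|A|%:R + #|C :\: A|%:R :> R.
    by rewrite -natrD -(cardsID A C) (setIidPr AC).
  have : eta * (#|X|%:R + #|X|%:R) <= eta * #|C|%:R.
    by rewrite ler_wpM2l // -natrD ler_nat addnn.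
  have : eta * (c * n) <= eta * #|C|%:R by rewrite ler_wpM2l.
  rewrite -(ler_nat R) natrD; lra.
- have [_ Bw [B0 _]] := pk_mem pk iF.
  have := hE i; rewrite Bw => /(_ wa B0 (or_introl iF)) h.
  split; first exact: subsetIr.
    rewrite -card_gt0 -(ltr_nat R); apply: le_lt_trans h.
    by rewrite mulr_ge0.
  by apply/ltW/(le_lt_trans hp).
- by apply: Nne => //; apply: leq_trans (ltnW Xw) wa.
- apply: hw; apply: le_trans hM _; rewrite ler_wpM2r ?ler_nat // exprn_ge0 //.
  by case/andP: p01 => _; rewrite subr_ge0.
have [|pk2] := packing_add pk Fr BA Bw cB.
  move=> B' /hB /set0Pn[v]; rewrite !in_setI => /andP[/andP[/ext_nbhdP[_ [x xB' vx]] _] vB].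
  by exists v, x.
by rewrite ltnNge (hmax _ _ pk2).
Qed.

(** * Choice of the parameters *)

Lemma nat_ceil (R : realType) (x : R) : 0 <= x ->
  exists k : nat, x <= k%:R /\ k%:R <= x + 1.
Proof.
move=> x0; have /andP[h1 h2] := truncn_itv x0.
by exists (Num.truncn x).+1; split; [exact: ltW|rewrite -natr1 lerD2r].
Qed.

Lemma nat_ceil2 (R : realType) (x : R) : 1 <= x ->
  exists k : nat, x <= k%:R /\ k%:R <= 2 * x.
Proof.
move=> x1; have [|k [h1 h2]] := @nat_ceil R x; first by lra.
by exists k; split=> //; lra.
Qed.

Lemma nat_floor2 (R : realType) (x : R) : 2 <= x ->
  exists k : nat, k%:R <= x /\ x <= 2 * k%:R.
Proof.
move=> x2; have /andP[h1 h2] := truncn_itv (le_trans (ler0n R 2) x2).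
by exists (Num.truncn x); split=> //; move: h2; rewrite -natr1; lra.
Qed.

(** With the fourth root [y] of [x], the bound [ln y <= y] gives
    [C * ln x <= 4 * C * y <= y ^+ 2]. *)
Lemma ln_le_sqrt (R : realType) (C x y : R) :
  0 <= C -> 1 <= y -> 4 * C <= y -> y ^+ 4 = x -> C * ln x <= y ^+ 2.
Proof.
move=> C0 y1 Cy <-; have y0 : 0 < y by lra.
have ly : ln y <= y by apply/ltW/ln_sublinear.
have ->: ln (y ^+ 4) = 4 * ln y by rewrite lnXn // mulr_natl.
have : C * ln y <= C * y by rewrite ler_wpM2l.
have : 4 * C * y <= y * y by rewrite ler_wpM2r // ltW.
rewrite expr2; lra.
Qed.

(** This follows from [1 - p <= expR (- p)]. *)
Lemma onem_exp_le (R : realType) (p x : R) (s : nat) :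
  p <= 1 -> 0 < x -> ln x <= p * s%:R -> (1 - p) ^+ s <= x^-1.
Proof.
move=> p1 x0 h; apply: (@le_trans _ _ (expR (- p) ^+ s)).
  by apply: lerXn2r; rewrite ?nnegrE ?subr_ge0 ?expR_ge0 // expR_ge1Dx.
rewrite -expRM_natl mulrN mulrC -[x in x^-1]lnK // expRN lef_pV2 ?posrE ?expR_gt0 //.
by rewrite ler_expR.
Qed.

Lemma nat_quotient (w m : nat) : (0 < m)%N -> (m <= w)%N ->
  (w %/ m * m <= w)%N /\ (w < 2 * (w %/ m * m))%N.
Proof.
move=> m0 mw; split; first exact: leq_trunc_div.
have := ltn_ceil w m0; have : (1 * m <= w %/ m * m)%N.
  by rewrite leq_mul2r divn_gt0 // mw orbT.
by rewrite mul1n mulSn; move: (w %/ m * m)%N => z; lia.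
Qed.

Lemma ln_ratio_ge2 (R : realType) (n t : R) :
  1 < t -> t ^+ 2 <= n -> 2 <= ln n / ln t.
Proof.
move=> t1 tn; have t0 : 0 < t by lra.
rewrite ler_pdivlMr ?ln_gt0 // mulr_natl -lnXn //.
have t20 : 0 < t ^+ 2 by rewrite exprn_gt0.
by rewrite ler_ln ?posrE //; apply: lt_le_trans tn.
Qed.

Lemma sqr_sqrt_width (R : realType) (n t : R) : 1 < n -> 0 < t ->
  Num.sqrt (n * ln n / t) ^+ 2 * t = n * ln n.
Proof.
move=> n1 t0; rewrite sqr_sqrtr ?divfK ?gt_eqF //.
by rewrite divr_ge0 ?mulr_ge0 // ?ln_ge0 ?(ltW n1) ?(ltW t0) //; lra.
Qed.

(** With [W] the width [Num.sqrt (n * ln n / t)], the target order becomes [S = W * t / ln n], so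
    that [S * W = n]: branch sets of size about [W] would just fill the graph. *)
Lemma sqrt_ratio (R : realType) (n t : R) : 1 < n -> 0 < t ->
  Num.sqrt (n * t / ln n) = Num.sqrt (n * ln n / t) * t / ln n.
Proof.
move=> n1 t0; have ln0 : 0 < ln n by apply: ln_gt0.
have WE := sqr_sqrt_width n1 t0; set W := Num.sqrt (n * ln n / t) in WE *.
have W0 : 0 <= W by apply: sqrtr_ge0.
have -> : n * t / ln n = (W * t / ln n) ^+ 2.
  rewrite expr_div_n exprMn [t ^+ 2]expr2 mulrA WE; field.
  by rewrite gt_eqF.
by rewrite sqrtr_sqr ger0_norm // divr_ge0 ?mulr_ge0 // ltW.
Qed.

(** As [t >= 4], [(t / 2) ^+ 2 >= t], so [l] about [2 * (ln n / ln t)] suffices. The ratio is at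
    least 2, which lets it absorb the additive constants. *)
Lemma depth_choice (R : realType) (n t : R) (q : nat) :
  4 <= t -> t ^+ 2 <= n -> exists l : nat,
  n <= (t / 2) ^+ l /\
  ((l + q).+1.*2)%:R <= (6 + q%:R) * (ln n / ln t).
Proof.
move=> t4 tn; have t1 : 1 < t by lra.
have lt0 : 0 < ln t by apply: ln_gt0.
have rho2 := ln_ratio_ge2 t1 tn.
have [|l [l1 l2]] := @nat_ceil R (2 * (ln n / ln t)); first by lra.
exists l; split; last first.
  rewrite -muln2 natrM -addn1 !natrD.
  have : q%:R * 2 <= q%:R * (ln n / ln t) by rewrite ler_wpM2l.
  lra.
have th0 : 0 < t / 2 by lra.
have n0 : 0 < n by apply: lt_le_trans tn; rewrite exprn_gt0 //; lra.
rewrite -ler_ln ?posrE ?exprn_gt0 //.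
rewrite lnXn // -[ln (t / 2) *+ l]mulr_natl.
have tt : 4 * t <= t * t by rewrite ler_wpM2r //; lra.
have h : ln t <= 2 * ln (t / 2).
  have <- : ln ((t / 2) ^+ 2) = 2 * ln (t / 2) by rewrite lnXn // mulr_natl.
  rewrite ler_ln ?posrE ?exprn_gt0 // ?expr2; lra.
have h2 : 2 * (ln n / ln t) * ln (t / 2) <= l%:R * ln (t / 2).
  by rewrite ler_wpM2r //; lra.
apply: le_trans h2.
have : ln n / ln t * ln t <= ln n / ln t * (2 * ln (t / 2)).
  by rewrite ler_wpM2l //; lra.
by rewrite divfK ?gt_eqF //; lra.
Qed.

(** Here [H] stands for the square root of [n] and [L] for [ln n]. The assumption [t <= H] enters
    here: after squaring, the last bound reduces to it and the lower bound on [H]. It makes branch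
    sets small enough to expand. *)
Lemma width_bounds (R : realFieldType) (alpha H t L Lam W : R) :
  0 < alpha < 1 -> 1 <= Lam -> 0 < t -> t <= H -> 0 < L ->
  64 * Lam ^+ 2 * L <= alpha ^+ 2 * H -> 0 <= W -> W ^+ 2 * t = H ^+ 2 * L ->
  [/\ L <= H, L <= W & 8 * Lam * (W * t) <= alpha * H ^+ 2].
Proof.
move=> /andP[al0 al1] Lam1 t0 tH L0 hA W0 WE.
have H0 : 0 < H by apply: lt_le_trans tH.
have LH : L <= H.
  have h1 : alpha ^+ 2 * H <= 1 * H.
    by rewrite ler_wpM2r ?expr_le1 // ltW.
  have h2 : 1 ^+ 2 <= Lam ^+ 2 by rewrite ler_pXn2r ?nnegrE // (le_trans ler01).
  have h3 : 1 * L <= 64 * Lam ^+ 2 * L.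
    rewrite ler_wpM2r ?(ltW L0) //; move: h2; rewrite expr1n; clear; lra.
  by move: h1 h3 hA; rewrite !mul1r => h1 h3 hA; apply: le_trans (le_trans hA h1).
split=> //.
  rewrite -(@ler_pXn2r _ 2) ?nnegrE ?(ltW L0) //.
  rewrite -(ler_pM2r t0) WE expr2 -mulrA mulrC ler_wpM2r ?(ltW L0) //.
  by rewrite expr2 ler_pM // ltW.
have Lam0 : 0 <= Lam by apply: le_trans Lam1.
have al00 := ltW al0; have H00 := ltW H0; have t00 := ltW t0; have L00 := ltW L0.
rewrite -(@ler_pXn2r _ 2) ?nnegrE ?mulr_ge0 ?exprn_ge0 //.
have -> : (8 * Lam * (W * t)) ^+ 2 = (64 * Lam ^+ 2 * (W ^+ 2 * t)) * t by ring.
rewrite WE.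
have -> : 64 * Lam ^+ 2 * (H ^+ 2 * L) * t
  = 64 * Lam ^+ 2 * L * (H ^+ 2 * t) by ring.
have -> : (alpha * H ^+ 2) ^+ 2 = alpha ^+ 2 * H * (H ^+ 2 * H) by ring.
apply: ler_pM; rewrite ?mulr_ge0 ?exprn_ge0 //.
by rewrite ler_wpM2l // exprn_ge0.
Qed.

(** With [tau = ln t] and density [p = t / 2 * w / n], this is [p * s >= 2 * ln t]. Since
    [s >= w * tau / (8 * K * L)], the product [p * s] is at least
    [t * w ^+ 2 * tau / (16 * K * n * L)], which is at least [64 * K * tau]. *)
Lemma hitting_rate (R : realFieldType) (K n L tau t W w s d : R) :
  1 <= K -> 0 < n -> 0 < L -> 0 < tau -> 0 < t -> 0 <= W ->
  W ^+ 2 * t = n * L -> 32 * K * W <= w -> 0 <= s ->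
  w <= 8 * (s * d) -> d <= K * (L / tau) ->
  2 * tau <= t / 2 * w / n * s.
Proof.
move=> K1 n0 L0 tau0 t0 W0 WE Ww s0 wsd dK.
have K0 : 0 < K by apply: lt_le_trans K1.
have w0 : 0 <= w by apply: le_trans Ww; rewrite !mulr_ge0 // ltW.
have h1 : w * tau <= 8 * (s * (K * L)).
  rewrite -ler_pdivlMr //; apply: le_trans wsd _.
  by rewrite -!mulrA ler_wpM2l // ler_wpM2l.
have h2 : w * tau * (w * t) <= 8 * (s * (K * L)) * (w * t).
  by rewrite ler_wpM2r // mulr_ge0 // ltW.
have h3 : (32 * K * W) ^+ 2 <= w ^+ 2.
  by rewrite ler_pXn2r ?nnegrE ?mulr_ge0 // ltW.
have h4 : (32 * K * W) ^+ 2 * (t * tau) <= w ^+ 2 * (t * tau).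
  by rewrite ler_wpM2r // mulr_ge0 // ltW.
have h5 : (128 * K * (n * tau)) * (8 * K * L) <= (s * w * t) * (8 * K * L).
  have -> : (128 * K * (n * tau)) * (8 * K * L)
      = (32 * K) ^+ 2 * (n * L) * tau by ring.
  rewrite -WE.
  have -> : (32 * K) ^+ 2 * (W ^+ 2 * t) * tau
      = (32 * K * W) ^+ 2 * (t * tau) by ring.
  apply: le_trans h4 _.
  have -> : w ^+ 2 * (t * tau) = w * tau * (w * t) by ring.
  apply: le_trans h2 _.
  have -> : 8 * (s * (K * L)) * (w * t) = s * w * t * (8 * K * L) by ring.
  exact: lexx.
move: h5; rewrite ler_pM2r ?mulr_gt0 // => h5.
have -> : t / 2 * w / n * s = (s * w * t) / 2 / n by field; rewrite gt_eqF.
rewrite ler_pdivlMr // ler_pdivlMr //; apply: le_trans h5.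
have -> : 2 * tau * n * 2 = 4 * (n * tau) by ring.
rewrite ler_wpM2r ?mulr_ge0 ?(ltW n0) ?(ltW tau0) //; clear -K1; lra.
Qed.

(** Only a [1 / t ^+ 2] fraction is missed, so the crude path length [K * L] is affordable: [M * d]
    is at most [2 * xi * K * W / t]. *)
Lemma missed_cost (R : realFieldType) (K L t W S xi M d : R) :
  0 <= K -> 1 <= t -> 0 < L -> 0 <= W -> 0 <= S -> S * L = W * t -> 0 <= xi <= 1 ->
  0 <= M -> 0 <= d -> M * t ^+ 2 <= 2 * (xi * S) -> d <= K * L ->
  M * d <= 2 * (K * W).
Proof.
move=> K0 t1 L0 W0 S0 SL /andP[xi0 xi1] M0 d0 Mt dK.
have t0 : 0 < t by apply: lt_le_trans t1.
have h3 : M * t ^+ 2 * d <= 2 * (xi * S) * (K * L).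
  by rewrite ler_pM // mulr_ge0 // ltW // exprn_gt0.
rewrite -(ler_pM2r (exprn_gt0 2 t0)) mulrAC; apply: le_trans h3 _.
have -> : 2 * (xi * S) * (K * L) = 2 * K * xi * (S * L) by ring.
rewrite SL.
have -> : 2 * K * xi * (W * t) = 2 * (K * W) * (xi * t) by ring.
rewrite ler_wpM2l ?mulr_ge0 // expr2 ler_pM // ?(ltW t0) //.
exact: le_trans t1.
Qed.

(** Up to rounding, [a] is [alpha * n / (2 * t)], [w] is [Lam * W] and [r] is [xi * S]. The number
    [q] of slow steps is fixed beforehand, since [Lam] and [xi] depend on it. *)
Lemma parameter_choice (R : realType) (alpha n H t Lam xi : R) (q : nat) :
  n = H ^+ 2 -> Lam = 32 * (6 + q%:R) -> xi = alpha ^+ 2 / (4096 * Lam) ->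
  0 < alpha < 1 -> 4 <= t -> 1 <= ln t -> t <= H ->
  64 * Lam ^+ 2 * ln n <= alpha ^+ 2 * H -> 4 <= alpha * H ->
  (xi ^+ 2)^-1 <= H ->
  exists a l s w r : nat, [/\ xi * Num.sqrt (n * t / ln n) <= r%:R,
    (0 < w <= a)%N, 2 * t * a%:R <= alpha * n <= 4 * t * a%:R,
    (r * w)%:R <= alpha ^+ 2 * n / 1024 &
    [/\ n <= (t / 2) ^+ l, t / 2 * w%:R <= n &
    forall M : nat, M%:R <= r%:R * (1 - t / 2 * w%:R / n) ^+ s ->
     ((s + M) * (l + q).+1.*2 < w)%N]].
Proof.
move=> nE LamE xiE /andP[al0 al1] t4 lnt1 tH hA hB hC.
have [K KE] : exists K : R, K = 6 + q%:R by exists (6 + q%:R).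
have K6 : 6 <= K by rewrite KE lerDl.
rewrite -KE in LamE.
have t0 : 0 < t by clear -t4; lra.
have t1 : 1 < t by clear -t4; lra.
have H0 : 0 < H by apply: lt_le_trans tH.
have tn : t ^+ 2 <= n by rewrite nE ler_pXn2r ?nnegrE // ltW.
have n1 : 1 < n.
  apply: lt_le_trans tn; rewrite expr2.
  have : 4 * 4 <= t * t by rewrite ler_pM.
  clear; lra.
have n0 : 0 < n by apply: lt_trans n1.
have lnt0 : 0 < ln t by apply: lt_le_trans lnt1.
have rho2 : 2 <= ln n / ln t by apply: ln_ratio_ge2.
have lnn2 : 2 <= ln n.
  move: rho2; rewrite ler_pdivlMr //; clear -lnt1; lra.
have lnn0 : 0 < ln n by apply: lt_le_trans lnn2.
have rhoL : ln n / ln t <= ln n.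
  by rewrite ler_pdivrMr // ler_peMr // ltW.
have Lam0 : 192 <= Lam by rewrite LamE; clear -K6; lra.
have Lam1 : 1 <= Lam by clear -Lam0; lra.
have WE := sqr_sqrt_width n1 t0; rewrite sqrt_ratio //.
have := sqrtr_ge0 (n * ln n / t); move: (Num.sqrt _) WE => W WE W0.
have al01 : 0 < alpha < 1 by rewrite al0.
have [|lnH Wln LWt] := width_bounds al01 Lam1 t0 tH lnn0 hA W0.
  by rewrite -nE.
rewrite -nE in LWt.
have W1 : 2 <= W by apply: le_trans Wln.
have SW : W * t / ln n * W = n.
  have -> : W * t / ln n * W = W ^+ 2 * t / ln n.
    by field; rewrite gt_eqF.
  by rewrite WE mulfK // gt_eqF.
have Sln : W * t / ln n * ln n = W * t by rewrite divfK // gt_eqF.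
have S0 : 0 <= W * t / ln n by rewrite divr_ge0 ?mulr_ge0 // ltW.
move: (W * t / ln n) SW Sln S0 => S SW Sln S0.
have Lam4 : 1 <= 4096 * Lam by clear -Lam0; lra.
have al20 : 0 < alpha ^+ 2 by rewrite exprn_gt0.
have al21 : alpha ^+ 2 <= 1 by rewrite expr_le1 // ltW.
have xi0 : 0 < xi by rewrite xiE divr_gt0 //; apply: lt_le_trans Lam4.
have xi1 : xi <= 1.
  rewrite xiE ler_pdivrMr ?mul1r; first exact: le_trans Lam4.
  exact: lt_le_trans Lam4.
(* This fixes [xi]: rounding at most doubles [r] and [w], so [r * w] is at most
   [4 * (xi * Lam) * n]. *)
have xiLam : 4 * (xi * Lam) = alpha ^+ 2 / 1024.
  by rewrite xiE; field; rewrite gt_eqF //; apply: lt_le_trans Lam1.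
have xiS0 : 0 <= xi * S by rewrite mulr_ge0 // ltW.
have xiS : 1 <= xi * S.
  rewrite -(@ler_pXn2r _ 2) ?nnegrE //.
  rewrite expr1n exprMn -ler_pdivrMl ?exprn_gt0 // mulr1.
  apply: le_trans hC _.
  have SE : S ^+ 2 * ln n = H * (H * t).
    by rewrite expr2 -mulrA Sln mulrA SW nE; ring.
  rewrite -(ler_pM2r lnn0) SE ler_wpM2l ?(ltW H0) //.
  by apply: le_trans lnH _; rewrite ler_peMr // ltW.
have LW1 : 1 <= Lam * W.
  have : 1 * 1 <= Lam * W by rewrite ler_pM //; apply: le_trans W1; clear; lra.
  by rewrite mul1r.
have [r [r1 r2]] := nat_ceil2 xiS.
have [w [w1 w2]] := nat_ceil2 LW1.
have t20 : 0 < 2 * t by clear -t0; lra.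
have t40 : 0 < 4 * t by clear -t0; lra.
have [|a [a1 a2]] := @nat_floor2 R (alpha * n / (2 * t)).
  rewrite ler_pdivlMr //.
  have : 4 * t <= (alpha * H) * H by rewrite ler_pM // ltW.
  rewrite nE expr2; clear; lra.
have [l [l1 l2]] := depth_choice q t4 tn; rewrite -KE in l2.
have a1' : 2 * t * a%:R <= alpha * n.
  by move: a1; rewrite ler_pdivlMr // mulrC.
have a2' : alpha * n <= 4 * t * a%:R.
  move: a2; rewrite ler_pdivrMr //.
  have -> : 2 * a%:R * (2 * t) = 4 * t * a%:R by ring.
  by [].
have wa : w%:R <= a%:R :> R.
  rewrite -(ler_pM2l t40); apply: le_trans a2'; apply: le_trans LWt.
  have : t * w%:R <= t * (2 * (Lam * W)) by rewrite ler_wpM2l // ltW.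
  have -> : t * (2 * (Lam * W)) = 2 * (Lam * (W * t)) by ring.
  clear; lra.
(* The greedily chosen vertices, at [d] each, use at most a quarter of [w]. *)
exists a, l, (w %/ (4 * (l + q).+1.*2))%N, w, r.
set d := (l + q).+1.*2 in l2 *; set s := (w %/ _)%N.
have d0 : (0 < d)%N by rewrite double_gt0.
have K0 : 0 <= K by clear -K6; lra.
have dL : d%:R <= K * ln n by apply: le_trans l2 _; rewrite ler_wpM2l.
have dR : 4 * d%:R <= Lam * W.
  have h1 : K * ln n <= K * W by rewrite ler_wpM2l.
  have : 0 <= K * W by rewrite mulr_ge0.
  by rewrite LamE; move: h1 dL; clear; lra.
have dw : (4 * d <= w)%N.
  by rewrite -(ler_nat R) natrM; apply: le_trans w1.
have [|s1 s2] := @nat_quotient w (4 * d) _ dw; first by rewrite muln_gt0.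
have sd1 : 4 * (s%:R * d%:R) <= w%:R :> R.
  by rewrite -!natrM ler_nat; move: s1; rewrite -/s mulnCA.
have sd2 : w%:R <= 8 * (s%:R * d%:R) :> R.
  rewrite -!natrM ler_nat; move: (ltnW s2); rewrite -/s.
  by rewrite (mulnCA s 4) mulnA.
have wgt0 : 0 < w%:R :> R by apply: lt_le_trans w1; apply: lt_le_trans LW1.
have tw : t / 2 * w%:R <= n.
  have h1 : 2 * t * w%:R <= 2 * t * a%:R by rewrite ler_pM2l.
  have h2 : alpha * n <= 1 * n by rewrite ler_pM2r // ltW.
  have h3 : 0 <= t * w%:R by rewrite mulr_ge0 // ltW.
  by move: h1 h2 h3 a1'; clear; lra.
split=> //.
- by rewrite -(ltr_nat R) -(ler_nat R) wa andbT.
- by rewrite a1'.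
- rewrite natrM; apply: (@le_trans _ _ (2 * (xi * S) * (2 * (Lam * W)))).
    by rewrite ler_pM.
  have -> : 2 * (xi * S) * (2 * (Lam * W)) = 4 * (xi * Lam) * (S * W) by ring.
  by rewrite xiLam SW mulrAC.
split=> // M hM.
have ps : ln (t ^+ 2) <= t / 2 * w%:R / n * s%:R.
  rewrite lnXn // -[_ *+ 2]mulr_natl.
  apply: (hitting_rate (K := K) (W := W) _ n0 lnn0 lnt0 t0 W0 WE _ _ sd2 l2) => //.
    by clear -K6; lra.
  by rewrite -LamE.
have tt0 : 0 < t ^+ 2 by rewrite exprn_gt0.
have p1 : t / 2 * w%:R / n <= 1 by rewrite ler_pdivrMr // mul1r.
have ht := onem_exp_le p1 tt0 ps.
have hM2 : M%:R * d%:R <= 2 * (K * W).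
  apply: (missed_cost K0 (ltW t1) lnn0 W0 S0 Sln (xi := xi)) => //.
    by rewrite ltW.
  rewrite -ler_pdivlMr //; apply: le_trans hM _; apply: ler_pM => //.
  by rewrite exprn_ge0 // subr_ge0.
have KW : 0 < K * W.
  by rewrite mulr_gt0; clear -K6 W1; lra.
(* The hitting vertices cost at most [w / 4] and the missed sets at most [2 * (K * W)], which is
   [Lam * W / 16] and so at most [w / 16]. *)
rewrite mulnDl -(ltr_nat R) natrD !natrM.
by move: hM2 sd1 w1 KW; rewrite LamE; clear; lra.
Qed.

Theorem theorem1p3 (R : realType) (alpha : R) :
  0 < alpha < 1 ->
  exists (xi : R) (n0 t0 : nat),
    0 < xi /\
    forall (G : sgraph) (t : R),
      (n0 <= #|vertex G|)%N ->
      t0%:R <= t ->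
      t <= Num.sqrt (#|vertex G|%:R) ->
      expander G alpha t ->
      exists r : nat,
        xi * Num.sqrt (#|vertex G|%:R * t / ln (#|vertex G|%:R)) <= r%:R /\
        minor (complete_graph r) G.
Proof.
move=> al01; have /andP[al0 al1] := al01.
have al20 : 0 < alpha ^+ 2 by rewrite exprn_gt0.
(* Slow growth will gain [alpha ^+ 2 * n / 512] per step, so this [q], independent of [n] and [t],
   is enough. *)
have [q [q1 _]] := nat_ceil (ltW (divr_gt0 (ltr0n R 512) al20)).
set Lam : R := 32 * (6 + q%:R); set xi : R := alpha ^+ 2 / (4096 * Lam).
have Lam0 : 0 < Lam by rewrite mulr_gt0 ?ltr0n // ltr_wpDr ?ler0n ?ltr0n.
have xi0 : 0 < xi by rewrite divr_gt0 // mulr_gt0.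
pose C : R := 64 * Lam ^+ 2 / alpha ^+ 2.
have C0 : 0 <= C by rewrite /C divr_ge0 ?(ltW al20) // mulr_ge0 // exprn_ge0 // ltW.
(* The fourth root of [n] will be at least [Y], hence at least each summand; every largeness
   condition on [n] follows. *)
pose Y : R := 1 + 4 * C + 4 / alpha + (xi ^+ 2)^-1.
have e1 : 0 <= 4 / alpha by rewrite divr_ge0 // ltW.
have e2 : 0 <= (xi ^+ 2)^-1 by rewrite invr_ge0 exprn_ge0 // ltW.
have Y0 : 0 <= Y by rewrite /Y; move: C0 e1 e2; clear; lra.
have [n0 [hn0 _]] := nat_ceil (exprn_ge0 4 Y0).
have e3 : 0 <= 256 / alpha by rewrite divr_ge0 // ltW.
have e4 : 0 < expR 1 :> R by apply: expR_gt0.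
have [t0 [ht0 _]] := nat_ceil (addr_ge0 (addr_ge0 (ler0n R 4) e3) (ltW e4)).
exists xi, n0, t0; split=> // G t nG tt tH [_ t1 ex].
have {nG} nY : Y ^+ 4 <= #|G|%:R by apply: le_trans hn0 _; rewrite ler_nat.
have {tt ht0} [t4 te ta] : [/\ 4 <= t, expR 1 <= t & 256 / alpha <= t].
  by move: (le_trans ht0 tt) e3 e4; clear; split; lra.
have tpos : 0 < t by apply: lt_le_trans t1.
set n : R := #|G|%:R in nY tH ex *.
set H := Num.sqrt n in tH; pose y := Num.sqrt H.
have nE : n = H ^+ 2 by rewrite sqr_sqrtr.
have HE : H = y ^+ 2 by rewrite sqr_sqrtr ?sqrtr_ge0.
have yE : y ^+ 4 = n by rewrite nE HE -exprM.
have Yy : Y <= y by rewrite -(@ler_pXn2r _ 4) ?nnegrE ?sqrtr_ge0 // yE.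
have [y1 Cy ay xy] : [/\ 1 <= y, 4 * C <= y, 4 / alpha <= y & (xi ^+ 2)^-1 <= y].
  by move: Yy C0 e1 e2; rewrite /Y; clear; split; lra.
have yH : y <= H by rewrite HE expr2 ler_peMr // (le_trans ler01).
have n0' : 0 < n by rewrite -yE exprn_gt0 // (lt_le_trans ltr01).
have [||||a [l [s [w [r [hr wa /andP[a1 a2] rw [hl tw hM]]]]]]] :=
  @parameter_choice R alpha n H t Lam xi q nE erefl erefl al01 t4 _ tH.
- by rewrite -(expRK 1) ler_ln ?posrE.
- have := ln_le_sqrt C0 y1 Cy yE; rewrite -HE /C.
  by rewrite mulrAC ler_pdivrMr // [H * _]mulrC.
- by rewrite mulrC -ler_pdivrMr //; apply: le_trans yH.
- exact: le_trans yH.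
exists r; split=> //; have /andP[w0 wa'] := wa.
have al2n : alpha ^+ 2 * n <= alpha * n.
  by rewrite ler_pM2r // expr2 ler_piMr // ltW.
have an0 : 0 < alpha * n by rewrite mulr_gt0.
(* In units of [alpha ^+ 2 * n / 1024], [hgap] reads [1 + 1 + 2 <= 4]: garbage, branch sets, and the
   gain [g] against half of [eta * (c * n)]. The garbage bound uses [t >= 256 / alpha]. *)
apply: (@expander_complete_minor R G alpha t (alpha / 8) (alpha / 16)
  (alpha ^+ 2 * n / 512) (t / 2 * w%:R / n) a l q s w r) => //.
- move=> X hX; apply: ex.
  by rewrite ler_pdivlMr // mulrC.
- by move: al0 al1; clear; lra.
- by move: al0 al1; clear; lra.
- by rewrite divr_ge0 // mulr_ge0 // ltW.
- rewrite ler_pdivrMr // mul1r tw andbT.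
  by rewrite divr_ge0 ?(ltW n0') // mulr_ge0 // divr_ge0 // ltW.
- by move: a2; rewrite -/n; clear; lra.
- by move: rw al2n an0; rewrite -/n; clear; lra.
- rewrite -/n.
  have hd : 2 * (alpha / 16 * n + (r * w)%:R) / t <= alpha ^+ 2 * n / 1024.
    rewrite ler_pdivrMr //.
    apply: (@le_trans _ _ (alpha * n / 4)).
      by move: rw al2n an0; clear; lra.
    have : alpha ^+ 2 * n * (256 / alpha) <= alpha ^+ 2 * n * t.
      by rewrite ler_wpM2l // mulr_ge0 // ltW.
    have -> : alpha ^+ 2 * n * (256 / alpha) = 256 * (alpha * n).
      by field; rewrite gt_eqF.
    by clear; lra.
  have -> : alpha / 16 * (alpha / 8 * n) / 2 = alpha ^+ 2 * n / 256 by field.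
  by move: hd rw; clear; lra.
- rewrite -/n.
  have -> : q%:R * (alpha ^+ 2 * n / 512) = q%:R * alpha ^+ 2 * (n / 512) by field.
  have : 512 <= q%:R * alpha ^+ 2 by rewrite -ler_pdivrMr.
  move=> h; have : 512 * (n / 512) <= q%:R * alpha ^+ 2 * (n / 512).
    by rewrite ler_wpM2r // divr_ge0 // ltW.
  by rewrite [512 * _]mulrC divfK // pnatr_eq0.
by rewrite -/n divfK // gt_eqF.
Qed.
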